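(* Let $\Omega$ be a complete Reinhardt domain in $\mathbb{C}^n$, let $\lambda\geq 1$, $1\leq p<\infty$, and let $$C=\max\left\{\frac13,\ \left(\frac{\lambda-1}{2\lambda-1}\right)^{1/p}\right\}.$$ Then $$C\,A_p\left(\bigcup_{k=1}^{\infty}\mathcal{P}^{k}(\Omega,\mathbb{C}),\lambda\right)\ \leq\ A_p\left(H_{\infty}(\Omega,\mathbb{C}),\lambda\right)\ \leq\ A_p\left(\bigcup_{k=1}^{\infty}\mathcal{P}^{k}(\Omega,\mathbb{C}),\lambda\right).$$
   Context: A complete Reinhardt domain $\Omega\subset\mathbb{C}^n$ is a domain such that $(z_1,\dots,z_n)\in\Omega$ implies $(\eta_1e^{i\theta_1}z_1,\dots,\eta_ne^{i\theta_n}z_n)\in\Omega$ for all $\eta_i\in[0,1]$, $\theta_i\in\mathbb{R}$. $\mathbb{N}_0=\mathbb{N}\cup\{0\}$. $H_\infty(\Omega,\mathbb{C})$ is the set of bounded holomorphic functions $\Omega\to\mathbb{C}$, and $\mathcal{P}^k(\Omega,\mathbb{C})$ ($k\in\mathbb{N}$) is the set of $k$-homogeneous polynomials $\sum_{|\alpha|=k}c_\alpha z^\alpha$ with complex coefficients, regarded as functions on $\Omega$. A holomorphic $f$ on $\Omega$ has the monomial expansion $f(z)=\sum_{\alpha\in\mathbb{N}_0^n}c_\alpha(f)z^\alpha$, and $\|f\|_\Omega=\sup_{z\in\Omega}|f(z)|\in[0,\infty]$ (an inequality whose right-hand side is infinite is regarded as satisfied). For a set $\mathcal{F}$ of holomorphic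 functions on $\Omega$, the $\lambda_p$-arithmetic Bohr radius is $$A_p(\mathcal{F},\lambda)=\sup\left\{\frac1n\sum_{i=1}^n r_i\ :\ r\in\mathbb{R}^n_{\geq0},\ \sum_{\alpha\in\mathbb{N}_0^n}|c_\alpha(f)|^p r^{p\alpha}\leq\lambda\|f\|_\Omega^p\ \text{ for all } f\in\mathcal{F}\right\},$$ where $\mathbb{R}^n_{\geq0}=\{r\in\mathbb{R}^n: r_i\geq0,\ 1\leq i\leq n\}$. *)

(* Defs.v *)
From HB Require Import structures.
From mathcomp Require Import all_boot all_order all_algebra.
From mathcomp Require Import finmap complex.
From mathcomp Require Import all_classical all_reals all_analysis.
From mathcomp Require summability.

Set Implicit Arguments.
Unset Strict Implicit.
Unset Printing Implicit Defensive.

Import Order.TTheory GRing.Theory Num.Theory.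
Import ComplexField.Normc numFieldNormedType.Exports.

Local Open Scope classical_set_scope.
Local Open Scope ring_scope.
Local Open Scope complex_scope.

Notation multidx n := {ffun 'I_n -> nat}.
(* The regular module [^o] carries the topology of the complex numbers and their
   structure of normed space over themselves, so that [differentiable] below is
   complex differentiability. *)
Notation Cplx R := (R[i]^o).
Notation Cfun R n := ('rV[Cplx R]_n -> Cplx R).

Definition total_degree n (a : multidx n) : nat := (\sum_i a i)%N.

Definition monomial (R : realType) n (a : multidx n) (z : 'rV[Cplx R]_n) : Cplx R :=
  \prod_i z 0 i ^+ a i.

Definition complete_Reinhardt_domain (R : realType) n (Omega : set 'rV[Cplx R]_n) :=
  [/\ open Omega, connected Omega, Omega !=set0 &
      forall (z : 'rV[Cplx R]_n) (eta theta : 'I_n -> R),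
        Omega z -> (forall i, 0 <= eta i <= 1) ->
        Omega (\row_i ((eta i)%:C * (cos (theta i) +i* sin (theta i)) * z 0 i))].

Definition holomorphic_on (R : realType) n (Omega : set 'rV[Cplx R]_n) (f : Cfun R n) :=
  forall z, Omega z -> differentiable f z.

Definition sup_norm (R : realType) n (Omega : set 'rV[Cplx R]_n) (f : Cfun R n) : \bar R :=
  ereal_sup [set (normc (f z))%:E | z in Omega].

Definition H_infty (R : realType) n (Omega : set 'rV[Cplx R]_n) : set (Cfun R n) :=
  [set f | holomorphic_on Omega f /\
           exists M : R, forall z, Omega z -> normc (f z) <= M].

(* Functions are total in Rocq; only their values on [Omega] are constrained. *)
Definition homog_poly (R : realType) n (Omega : set 'rV[Cplx R]_n) (k : nat) :
    set (Cfun R n) :=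
  [set f | exists c : multidx n -> Cplx R, forall z, Omega z ->
     f z = \sum_(a \in [set a : multidx n | total_degree a = k]) c a * monomial a z].

(* Unconditional convergence: [summability.totally] is the filter of the finite
   sets of indices directed by inclusion. *)
Definition monomial_expansion (R : realType) n (Omega : set 'rV[Cplx R]_n)
    (f : Cfun R n) (c : multidx n -> Cplx R) :=
  forall z, Omega z ->
    summability.partial_sum (fun a => c a * monomial a z : Cplx R)
      @ summability.totally --> f z.

(* A holomorphic function on a complete Reinhardt domain has exactly one
   monomial expansion; the default value of [xget] only serves to make
   [coef] total. *)
Definition coef (R : realType) n (Omega : set 'rV[Cplx R]_n) (f : Cfun R n) :
    multidx n -> Cplx R :=
  xget (fun=> 0) [set c | monomial_expansion Omega f c].

(* [0 `^ 0 = 1], so a vanishing [r i] with a vanishing exponent contributes a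
   factor 1; [(+oo `^ p = +oo)%E] for [p != 0]. *)
Definition Bohr_admissible (R : realType) n (Omega : set 'rV[Cplx R]_n) (p : R)
    (F : set (Cfun R n)) (lambda : R) (r : 'rV[R]_n) :=
  (forall i, 0 <= r 0 i) /\
  forall f, F f ->
    (\esum_(a in [set: multidx n])
       (normc (coef Omega f a) `^ p * \prod_i r 0 i `^ (p * (a i)%:R))%:E
     <= lambda%:E * sup_norm Omega f `^ p)%E.

Definition arith_Bohr_radius (R : realType) n (Omega : set 'rV[Cplx R]_n) (p : R)
    (F : set (Cfun R n)) (lambda : R) : \bar R :=
  ereal_sup [set (n%:R^-1 * \sum_i r 0 i)%:E |
             r in [set r | Bohr_admissible Omega p F lambda r]].

(* Main.v *)
Require Import Defs.
From mathcomp Require Import all_boot all_order all_algebra.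
From mathcomp Require Import finmap complex.
From mathcomp Require Import all_classical all_reals all_analysis.
From mathcomp Require Import ring lra zify.
From mathcomp Require summability.

Import Order.TTheory GRing.Theory Num.Theory.
Import numFieldNormedType.Exports.
Local Open Scope classical_set_scope.
Local Open Scope ring_scope.
Import ComplexField.Normc.
Set Implicit Arguments.
Unset Strict Implicit.

(** For the lower bound, write [f = \sum_k f_k] with [f_k] the [k]-homogeneous
    part and let [M] be the sup norm of [f]. Averaging [f] over the rotations of
    [z] by the [N]-th roots of unity, and letting [N] grow, isolates [f_k z];
    hence [|f_k| <= M] and, by a discrete form of Caratheodory's inequality,
    [|f_k| <= 2 (M - |f 0|)] for [k > 0]. Applying the admissibility of [r] to
    every [f_k] and scaling [r] by [C] leaves the bound
    [|f 0|^p + lambda \sum_(k > 0) C^(p k) |f_k|^p <= lambda M^p]: for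
    [C^p = (lambda - 1) / (2 lambda - 1)] it is a geometric series with
    [|f_k| <= M], and for [C = 1/3] it follows from [x^p <= x] on [[0, 1]] and
    [|f_k| <= 2 (M - |f 0|)].

    Cauchy's theorem is never needed: a function without a monomial expansion
    has [coef] equal to 0, for which the required inequality is trivial.
    For the upper bound, a homogeneous polynomial either is in [H_infty] or has
    infinite sup norm. *)

(** * Moduli, real parts and conjugates of complex numbers *)

Section ComplexModulus.
Variable R : realType.
Implicit Types x y : R[i].

Lemma normc_ge0 x : 0 <= normc x.
Proof. by case: x => a b; exact: sqrtr_ge0. Qed.

Lemma normc_normE x : (normc x)%:C%C = `|x|.
Proof. by []. Qed.

Lemma normcD x y : normc (x + y) <= normc x + normc y.
Proof. exact: (@le_normcD R x y). Qed.

Lemma normcB x y : normc (x - y) <= normc x + normc y.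
Proof. by rewrite (le_trans (normcD _ _))// (@normcN R y). Qed.

Lemma normc_distC x y : normc (x - y) = normc (y - x).
Proof. by rewrite -(@normcN R (x - y)) -opprB opprK. Qed.

Lemma normc_sum (I : Type) (s : seq I) (P : pred I) (F : I -> R[i]) :
  normc (\sum_(i <- s | P i) F i) <= \sum_(i <- s | P i) normc (F i).
Proof.
elim/big_rec2: _ => [|i y x _ xy]; first by rewrite normc0.
by rewrite (le_trans (normcD _ _))// lerD2l.
Qed.

Lemma normc_conj x : normc x^*%C = normc x.
Proof. by case: x => a b /=; rewrite sqrrN. Qed.

Lemma Re_le_normc x : complex.Re x <= normc x.
Proof.
case: x => a b /=; rewrite (le_trans (ler_norm a))// -sqrtr_sqr.
by rewrite ler_wsqrtr// lerDl sqr_ge0.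
Qed.

Lemma normc_real (a : R) : 0 <= a -> normc a%:C%C = a.
Proof. by move=> a0; rewrite /= expr0n addr0 sqrtr_sqr ger0_norm. Qed.

Lemma normcX x k : normc (x ^+ k) = normc x ^+ k.
Proof. by elim: k => [|k IH]; rewrite ?expr0 ?normc1// !exprS normcM IH. Qed.

Lemma normc_natr k : normc (k%:R : R[i]) = k%:R.
Proof. by rewrite -(rmorph_nat (real_complex R)) normc_real. Qed.

Lemma ReD (x y : R[i]) : complex.Re (x + y) = complex.Re x + complex.Re y.
Proof. by case: x y => [a b] [a' b']. Qed.

Lemma Re_sum (I : Type) (s : seq I) (F : I -> R[i]) :
  complex.Re (\sum_(i <- s) F i) = \sum_(i <- s) complex.Re (F i).
Proof. by elim/big_rec2: _ => // i x y _ <-; rewrite ReD. Qed.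

Lemma ReZ (r : R) (x : R[i]) : complex.Re (r%:C%C * x) = r * complex.Re x.
Proof. by case: x => a b /=; ring. Qed.

Lemma rotate_to_nonneg (x : R[i]) :
  exists2 b : R[i], normc b = 1 & b * x = (normc x)%:C%C.
Proof.
have [->|x0] := eqVneq x 0.
  by exists 1; rewrite ?normc1// mulr0 normc0.
have nx0 : normc x != 0 by apply: contra_neq x0; exact: eq0_normc.
exists ((normc x)%:C%C / x); last by rewrite divfK.
by rewrite normcM normcV normc_real ?normc_ge0// divff.
Qed.

(** Inversion is conjugation on the unit circle, so conjugating the weights of a Fourier average
    reverses its frequency. *)
Lemma conjc_unit_exp (x : R[i]) N k j : normc x = 1 ->
  (N%:R^-1 * (x ^+ k) ^+ j)^*%C = N%:R^-1 * (x ^- k) ^+ j.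
Proof.
move=> x1; have x0 : x != 0.
  by apply: contra_eqN x1 => /eqP->; rewrite normc0 eq_sym oner_eq0.
have cx : x^*%C = x^-1.
  by apply: (mulfI x0); rewrite divff// -sqr_normc -normc_normE x1 expr1n.
by rewrite rmorphM !rmorphXn fmorphV rmorph_nat /= cx !exprVn.
Qed.

End ComplexModulus.

(** * Roots of unity *)

Section RootsOfUnity.
Variable R : realType.

Definition unity_root_exp (N : nat) : R[i] :=
  (cos (2 * pi / N%:R) +i* sin (2 * pi / N%:R))%C.

Lemma de_Moivre (x : R) k :
  ((cos x +i* sin x) ^+ k)%C = (cos (k%:R * x) +i* sin (k%:R * x))%C.
Proof.
elim: k => [|k IH]; first by rewrite mul0r cos0 sin0 expr0.
rewrite exprS IH -natr1 mulrDl mul1r cosD sinD.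
by apply/eqP; rewrite eq_complex /=; apply/andP; split; apply/eqP; ring.
Qed.

Lemma unity_root_exp_prim N : (0 < N)%N -> N.-primitive_root (unity_root_exp N).
Proof.
move=> N0; apply/andP; split => //; apply/forallP => -[i iN]; apply/eqP => /=.
have N0' : N%:R != 0 :> R by rewrite pnatr_eq0 -lt0n.
rewrite unity_rootE de_Moivre.
have [->|iN1] := eqVneq i.+1 N.
  rewrite mulrCA divff// mulr1.
  have -> : 2 * pi = 0 + pi *+ 2 :> R by ring.
  rewrite cosD2pi sinD2pi cos0 sin0.
  by rewrite eq_complex /= !eqxx.
(* Below [N] the angle is [2y] with [0 < y < pi], so [sin y > 0], whereas [cos (2y) = 1] would force
   [sin y = 0]. *)
apply/negbTE/negP; rewrite eq_complex /= => /andP[/eqP c1 _].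
set y := i.+1%:R * (pi / N%:R) : R.
have yE : i.+1%:R * (2 * pi / N%:R) = y *+ 2 by rewrite /y; ring.
move: c1; rewrite yE cos_mulr2n cos2sin2 => c1.
have : 0 < sin y.
  apply: sin_gt0_pi; rewrite /y; apply/andP; split.
    by rewrite mulr_gt0// divr_gt0 ?pi_gt0// ltr0n.
  rewrite mulrCA gtr_pMr ?pi_gt0// ltr_pdivrMr ?ltr0n// mul1r ltr_nat.
  by rewrite ltn_neqAle iN1 iN.
by nra.
Qed.

Lemma normc_unity_root_exp N : normc (unity_root_exp N) = 1.
Proof. by rewrite /unity_root_exp /= cos2Dsin2 sqrtr1. Qed.

Lemma unity_root_exp_neq0 N : unity_root_exp N != 0.
Proof.
apply/eqP => r0; have /eqP := normc_unity_root_exp N.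
by rewrite r0 normc0 eq_sym oner_eq0.
Qed.

Lemma sum_unity_root (F : fieldType) (N : nat) (r : F) : r ^+ N = 1 -> r != 1 ->
  \sum_(j < N) r ^+ j = 0.
Proof.
move=> rN r1; apply/eqP; have /eqP := subrX1 r N.
by rewrite rN subrr eq_sym mulf_eq0 subr_eq0 (negbTE r1).
Qed.

Lemma mean_const N (x : R) : (0 < N)%N -> \sum_(j < N) N%:R^-1 * x = x.
Proof.
move=> N0; rewrite sumr_const card_ord -[LHS]mulr_natl mulrA divff ?mul1r//.
by rewrite pnatr_eq0 -lt0n.
Qed.

End RootsOfUnity.

(** * Unconditional summation *)

Section UnconditionalSums.
Variables (R : realType) (I : choiceType).
Implicit Types (t : I -> Cplx R) (s : Cplx R) (A S : {fset I}).

Lemma partial_sumE t A : summability.partial_sum t A = \sum_(a <- A) t a.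
Proof. exact/esym/big_seq_fsetE. Qed.

Definition has_sum t s :=
  summability.partial_sum t @ summability.totally --> s.

#[local] Existing Instance summability.totally_filter.

Lemma has_sumP t s : has_sum t s <->
  forall e : R, 0 < e -> exists A0, forall A, (A0 `<=` A)%fset ->
    normc (\sum_(a <- A) t a - s) < e.
Proof.
split=> [/cvgrPdist_lt ts e e0|ts].
  have /ts [A0 _ A0P] : 0 < (e%:C)%C :> R[i] by rewrite ltcR.
  exists A0 => A /A0P /=; rewrite partial_sumE.
  by rewrite normc_distC -normc_normE ltcR.
apply/cvgrPdist_lt => /= e e0.
(* A positive element of [R[i]] is real, so the radius may be replaced by its real part. *)
have eR : (complex.Re e)%:C%C = e by rewrite RRe_real// gtr0_real.
move: e0; rewrite -eR ltcR => /ts[A0 A0P]; exists A0 => // A /A0P /=.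
rewrite partial_sumE.
by rewrite normc_distC -normc_normE ltcR.
Qed.

Lemma has_sum_lin (J : finType) (w : J -> Cplx R) (t : J -> I -> Cplx R)
    (s : J -> Cplx R) :
  (forall j, has_sum (t j) (s j)) ->
  has_sum (fun a => \sum_j w j * t j a) (\sum_j w j * s j).
Proof.
move=> ts; rewrite /has_sum.
have -> : summability.partial_sum (fun a => \sum_j w j * t j a) =
    fun A => \sum_j w j * summability.partial_sum (t j) A.
  apply/funext => A; rewrite /summability.partial_sum exchange_big/=.
  by apply: eq_bigr => j _; rewrite mulr_sumr.
elim: (index_enum J) => [|j r IH].
  under eq_fun do rewrite big_nil.
  by rewrite big_nil; exact: cvg_cst.
under eq_fun do rewrite big_cons.
rewrite big_cons; apply: cvgD => //.
by apply: cvgM; [exact: cvg_cst|exact: ts].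
Qed.

(* A Cauchy tail bound; no absolute convergence is needed because the
   multipliers [K] only take the values 0 and 1. *)
Lemma has_sum_select t s S (e : R) : has_sum t s -> 0 < e ->
  exists A0, forall (K : I -> Cplx R) s', (forall a, K a = 0 \/ K a = 1) ->
    (forall a, a \in A0 -> K a = (a \in S)%:R) ->
    has_sum (fun a => K a * t a) s' ->
    normc (s' - \sum_(a <- S) t a) <= e.
Proof.
move=> /has_sumP ts e0; have e4 : 0 < e / 4 by lra.
have [A1 A1P] := ts _ e4.
have [A0 A1A0 SA0] : exists2 A0, (A1 `<=` A0)%fset & (S `<=` A0)%fset.
  by exists (A1 `|` S)%fset; rewrite ?fsubsetUl ?fsubsetUr.
exists A0 => K s' K01 KS /has_sumP.
move=> /(_ _ e4)[A2 A2P].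
(* [B] holds the indices of [A] outside [A0] that [K] keeps. The sum of [t] over [B] is small: [A0]
   and its union with [B] both contain [A1], so both partial sums are close to [s]. *)
set A := (A0 `|` A2)%fset; set B := [fset a in A | (a \notin A0) && (K a == 1)]%fset.
have A0A : (A0 `<=` A)%fset by exact: fsubsetUl.
have /A2P As : (A2 `<=` A)%fset by exact: fsubsetUr.
have A0s := A1P _ A1A0.
have /A1P A0Bs : (A1 `<=` A0 `|` B)%fset.
  exact: fsubset_trans A1A0 (fsubsetUl _ _).
move: A0Bs; rewrite (big_fsetID _ (mem A0)) /=.
have -> : [fset a in A0 `|` B | a \in A0]%fset = A0.
  by apply/fsetP => a; rewrite !inE; case: (a \in A0); rewrite ?andbF.
have -> : [fset a in A0 `|` B | a \notin A0]%fset = B.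
  by apply/fsetP => a; rewrite !inE; case: (a \in A0); rewrite ?andbF ?andbT.
move=> A0Bs.
have AE : \sum_(a <- A) K a * t a = \sum_(a <- S) t a + \sum_(a <- B) t a.
  have -> : S = [fset a in A | a \in S]%fset.
    apply/fsetP => a; rewrite !inE; have [aS|] := boolP (a \in S).
      by rewrite (fsubsetP SA0).
    by rewrite andbF.
  rewrite !big_fset /= 2![X in _ = X + _]big_mkcond [X in _ = _ + X]big_mkcond.
  rewrite -big_split /=; apply: eq_bigr => a _.
  have [aA0|aA0] := boolP (a \in A0); last first.
    have /negbTE -> : a \notin S by apply: contra aA0 => /(fsubsetP SA0).
    rewrite add0r /=; case: (K01 a) => ->.
      by rewrite mul0r eq_sym oner_eq0.
    by rewrite eqxx mul1r.
  by rewrite addr0 KS//; case: ifP => _; rewrite ?mul1r ?mul0r.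
move: As; rewrite AE => As.
set X := \sum_(a <- S) t a in As *; set Y := \sum_(a <- B) t a in As A0Bs *.
set Z := \sum_(a <- A0) t a in A0s A0Bs.
have -> : s' - X = ((Z + Y - s) - (Z - s)) - (X + Y - s') by ring.
by rewrite (le_trans (normcB _ _))// (le_trans (lerD (normcB _ _) (lexx _)))//; lra.
Qed.

End UnconditionalSums.

(** * Homogeneous parts and rotations of the coordinates *)

Section Homogeneous.
Variables (R : realType) (n : nat).
Implicit Types (z : 'rV[Cplx R]_n) (c : multidx n -> Cplx R).

Lemma total_degree_finite k : finite_set [set a : multidx n | total_degree a = k].
Proof.
apply: (@sub_finite_set _ _
  ((fun b : {ffun 'I_n -> 'I_k.+1} => [ffun i => b i : nat]) @` setT)).
  move=> a /= <-; exists [ffun i => inord (a i)] => //.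
  apply/ffunP => i; rewrite !ffunE inordK// ltnS /total_degree.
  by rewrite (bigD1 i)//= leq_addr.
exact: finite_image.
Qed.

Definition degree_fset k : {fset multidx n} :=
  fset_set [set a : multidx n | total_degree a = k].

Lemma in_degree_fset k a : (a \in degree_fset k) = (total_degree a == k).
Proof.
rewrite in_fset_set; last exact: total_degree_finite.
by apply/idP/eqP; rewrite inE.
Qed.

Definition homog_part c k z : Cplx R :=
  \sum_(a <- degree_fset k) c a * monomial a z.

Definition scale_coords (u : 'I_n -> Cplx R) z : 'rV[Cplx R]_n :=
  \row_i (u i * z 0 i).

Lemma monomial_scale u a z :
  monomial a (scale_coords u z) = (\prod_i u i ^+ a i) * monomial a z.
Proof.
rewrite /monomial -big_split /=; apply: eq_bigr => i _.
by rewrite mxE exprMn.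
Qed.

Lemma Reinhardt_rotate (Omega : set 'rV[Cplx R]_n) N (m : 'I_n -> nat) z :
  complete_Reinhardt_domain Omega -> Omega z ->
  Omega (scale_coords (fun i => unity_root_exp R N ^+ m i) z).
Proof.
move=> [_ _ _ rein] Oz.
have := rein z (fun=> 1) (fun i => (m i)%:R * (2 * pi / N%:R)) Oz.
move=> /(_ _); rewrite /scale_coords; under eq_mx do rewrite mul1r -de_Moivre.
by apply => i; rewrite ler01 lexx.
Qed.

(** Orthogonality of the characters of the cyclic group of order [N]. It produces the 0-1
    multipliers that [has_sum_select] asks for. *)
Lemma root_average (N : nat) (r : Cplx R) : (0 < N)%N -> r ^+ N = 1 ->
  \sum_(j < N) N%:R^-1 * r ^+ j = (r == 1)%:R.
Proof.
move=> N0 rN; rewrite -mulr_sumr; have [->|r1] := eqVneq r 1.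
  under eq_bigr do rewrite expr1n.
  by rewrite sumr_const card_ord mulVf// pnatr_eq0 -lt0n.
by rewrite (sum_unity_root rN r1) mulr0.
Qed.

(** Scaling the coordinates multiplies each monomial by a constant, so a weighted mean of values of
    [f] acts on the expansion as a multiplier. *)
Lemma expansion_average (Omega : set 'rV[Cplx R]_n) f c z (J : finType)
    (w : J -> Cplx R) (u : J -> 'I_n -> Cplx R) :
  monomial_expansion Omega f c -> (forall j, Omega (scale_coords (u j) z)) ->
  has_sum (fun a : multidx n =>
      (\sum_j w j * \prod_i u j i ^+ a i) * (c a * monomial a z))
    (\sum_j w j * f (scale_coords (u j) z)).
Proof.
move=> fc Ou.
have -> : (fun a : multidx n =>
      (\sum_j w j * \prod_i u j i ^+ a i) * (c a * monomial a z)) =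
    fun a : multidx n => \sum_j w j * (c a * monomial a (scale_coords (u j) z)).
  apply/funext => a; rewrite mulr_suml; apply: eq_bigr => j _.
  by rewrite monomial_scale; ring.
by apply: has_sum_lin => j; exact: fc.
Qed.

End Homogeneous.

(** * Discrete Fourier averages over circles and tori *)

Section Averages.
Variables (R : realType) (n : nat) (Omega : set 'rV[Cplx R]_n).
Hypothesis Omega_Reinhardt : complete_Reinhardt_domain Omega.
Variables (f : Cfun R n) (c : multidx n -> Cplx R).
Hypothesis fc : monomial_expansion Omega f c.
Variable z : 'rV[Cplx R]_n.
Hypothesis Oz : Omega z.
Local Notation root := (unity_root_exp R).

(** For [v = root N ^- k] this is the discrete Fourier coefficient of index [k] of [f] along the
    circle through [z]. *)
Definition circle_average N (v : Cplx R) : Cplx R :=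
  \sum_(j < N) (N%:R^-1 * v ^+ j) * f (scale_coords (fun=> root N ^+ j) z).

(** The average keeps the terms with [v * root N ^+ total_degree a = 1]. Degrees are seen only
    modulo [N], so unwanted terms may survive, but only outside [A0], where their total is
    negligible. *)
Lemma circle_average_select (S : {fset multidx n}) e : 0 < e ->
  exists A0 : {fset multidx n}, forall N (v : Cplx R), (0 < N)%N -> v ^+ N = 1 ->
    (forall a, a \in A0 -> (v * root N ^+ total_degree a == 1) = (a \in S)) ->
    normc (circle_average N v - \sum_(a <- S) c a * monomial a z) <= e.
Proof.
move=> e0; have [A0 A0P] := has_sum_select S (fc Oz) e0.
exists A0 => N v N0 vN vS.
have rN : root N ^+ N = 1 := prim_expr_order (unity_root_exp_prim R N0).
pose K (a : multidx n) : Cplx R := (v * root N ^+ total_degree a == 1)%:R.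
apply: (A0P K) => [a|a aA0|].
- by rewrite /K; case: eqP; [right|left].
- by rewrite /K vS.
have -> : (fun a : multidx n => K a * (c a * monomial a z)) = (fun a : multidx n =>
    (\sum_(j < N) (N%:R^-1 * v ^+ j) * \prod_i (root N ^+ j) ^+ a i) *
    (c a * monomial a z)).
  apply/funext => a; congr (_ * _); rewrite /K -(root_average N0).
    by apply: eq_bigr => j _; rewrite prodrXr exprMn mulrA -!exprM mulnC.
  by rewrite exprMn vN mul1r exprAC rN expr1n.
apply: (@expansion_average _ _ Omega) => // j.
exact: Reinhardt_rotate.
Qed.

Lemma homog_part_average k e : 0 < e -> exists N0, forall N, (N0 < N)%N ->
  normc (circle_average N (root N ^- k) - homog_part c k z) <= e.
Proof.
move=> /(circle_average_select (degree_fset n k))[A0 A0P].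
(* Beyond this bound [k] and all degrees in [A0] are smaller than [N], so congruence modulo [N] is
   equality. *)
exists (k + \max_(a <- A0) total_degree a)%N => N N0.
have Ngt0 : (0 < N)%N by case: N N0.
have prim := unity_root_exp_prim R Ngt0.
have rneq0 : root N != 0 := unity_root_exp_neq0 R N.
apply: A0P => // [|a aA0].
  by rewrite exprVn exprAC (prim_expr_order prim) expr1n invr1.
rewrite in_degree_fset mulrC -(inj_eq (mulIf (expf_neq0 k rneq0))).
rewrite divfK ?expf_neq0// mul1r (eq_prim_root_expr prim).
have aN : (total_degree a < N)%N.
  rewrite (leq_ltn_trans _ N0)// (leq_trans _ (leq_addl _ _))//.
  by rewrite (leq_bigmax_seq _ aA0).
by rewrite !modn_small// (leq_ltn_trans _ N0)// leq_addr.
Qed.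

(** No monomial has degree [- k]: the surviving terms have [k + total_degree a] divisible by [N],
    and for large [N] none of them lies in [A0]. *)
Lemma negative_average k e : (0 < k)%N -> 0 < e -> exists N0, forall N, (N0 < N)%N ->
  normc (circle_average N (root N ^+ k)) <= e.
Proof.
move=> k0 /(circle_average_select fset0)[A0 A0P].
exists (k + \max_(a <- A0) total_degree a)%N => N N0.
have Ngt0 : (0 < N)%N by case: N N0.
have prim := unity_root_exp_prim R Ngt0.
move: (A0P N (root N ^+ k)); rewrite big_seq_fset0 subr0; apply => // [|a aA0].
  by rewrite exprAC (prim_expr_order prim) expr1n.
rewrite inE -exprD -[X in _ == X](expr0 (root N)) (eq_prim_root_expr prim) mod0n.
rewrite modn_small; first by rewrite addn_eq0 (gtn_eqF k0).
by rewrite (leq_ltn_trans _ N0)// leq_add2l (leq_bigmax_seq _ aA0).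
Qed.

(** The discrete Fourier coefficient of index [b] on a product of circles. Independent rotations
    separate monomials of equal degree. *)
Definition torus_average N (b : multidx n) : Cplx R :=
  \sum_(j : {ffun 'I_n -> 'I_N}) (\prod_i (N%:R^-1 * (root N ^- b i) ^+ j i)) *
     f (scale_coords (fun i => root N ^+ j i) z).

Lemma coef_average (b : multidx n) e : 0 < e -> exists N0, forall N, (N0 < N)%N ->
  normc (torus_average N b - c b * monomial b z) <= e.
Proof.
move=> e0; have [A0 A0P] := has_sum_select [fset b]%fset (fc Oz) e0.
exists (\max_(a <- (b |` A0)%fset) total_degree a)%N => N N0.
have Ngt0 : (0 < N)%N by case: N N0.
have prim := unity_root_exp_prim R Ngt0.
have rneq0 : root N != 0 := unity_root_exp_neq0 R N.
have small a i : a \in (b |` A0)%fset -> (a i < N)%N.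
  move=> aA; apply: leq_ltn_trans N0; apply: leq_trans (leq_bigmax_seq _ aA _) => //.
  by rewrite /total_degree (bigD1 i)//= leq_addr.
pose K (a : multidx n) : Cplx R := \prod_i (root N ^- b i * root N ^+ a i == 1)%:R.
have KE a : K a = [forall i, root N ^- b i * root N ^+ a i == 1]%:R.
  rewrite /K; case: (boolP [forall i, _]) => [/forallP ab|/forallPn[i /negbTE ab]].
    by rewrite big1// => i _; rewrite ab.
  by rewrite (bigD1 i)//= ab mul0r.
move: (A0P K (torus_average N b)); rewrite big_seq_fset1; apply.
- by move=> a; rewrite KE; case: [forall _, _]; [right|left].
- move=> a aA0; rewrite KE inE; congr (_%:R); congr nat_of_bool.
  apply/forallP/eqP => [ab|-> i]; last by rewrite mulVf// expf_neq0.
  apply/ffunP => i; move: (ab i).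
  rewrite mulrC -(inj_eq (mulIf (expf_neq0 (b i) rneq0))) divfK ?expf_neq0//.
  rewrite mul1r (eq_prim_root_expr prim) !modn_small; first by move/eqP.
    by apply: small; rewrite !inE eqxx.
  by apply: small; rewrite !inE aA0 orbT.
have -> : (fun a : multidx n => K a * (c a * monomial a z)) = (fun a : multidx n =>
    (\sum_(j : {ffun 'I_n -> 'I_N}) (\prod_i (N%:R^-1 * (root N ^- b i) ^+ j i)) *
      \prod_i (root N ^+ j i) ^+ a i) *
    (c a * monomial a z)).
  apply/funext => a; congr (_ * _).
  under [RHS]eq_bigr do rewrite -big_split /=.
  (* Distributivity turns the sum over the grid into a product of one-variable averages, each given
     by [root_average]. *)
  rewrite -(bigA_distr_bigA (fun i (j : 'I_N) =>
    N%:R^-1 * (root N ^- b i) ^+ j * (root N ^+ j) ^+ a i)).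
  apply: eq_bigr => i _; rewrite -(root_average Ngt0).
    by apply: eq_bigr => j _; rewrite exprMn mulrA [in RHS]exprAC.
  rewrite exprMn exprVn -exprM mulnC exprM (prim_expr_order prim) expr1n invr1 mul1r.
  by rewrite -exprM mulnC exprM (prim_expr_order prim) expr1n.
apply: (@expansion_average _ _ Omega) => // j.
exact: Reinhardt_rotate.
Qed.

End Averages.

(** * Uniqueness of the monomial expansion *)

Section Uniqueness.
Variables (R : realType) (n : nat) (Omega : set 'rV[Cplx R]_n).
Hypothesis Omega_Reinhardt : complete_Reinhardt_domain Omega.
Implicit Types (f : Cfun R n) (c : multidx n -> Cplx R) (z : 'rV[Cplx R]_n).

(** Taking [eta = 0] puts the origin in [Omega], and openness then yields a small constant vector.
    At such a point every monomial can be cancelled. *)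
Lemma Reinhardt_nonzero_point :
  exists2 z, Omega z & forall i, z 0 i != 0.
Proof.
have [Oo _ [z0 Oz0] rein] := Omega_Reinhardt.
have O0 : Omega 0.
  have := rein z0 (fun=> 0) (fun=> 0) Oz0.
  rewrite (_ : \row_i _ = 0); first by apply => i; rewrite lexx ler01.
  by apply/rowP => i; rewrite !mxE mul0r mul0r.
have /nbhs_ballP[e /= e0 eO] : nbhs (0 : 'rV[Cplx R]_n) Omega.
  exact: open_nbhs_nbhs.
exists (const_mx (e / 2)) => [|i].
  apply: eO; split=> // i j; rewrite !mxE /ball /= sub0r normrN.
  by rewrite gtr0_norm ?divr_gt0// ltr_pdivrMr// ltr_pMr// ltr1n.
by rewrite mxE gt_eqF// divr_gt0.
Qed.

(** The torus averages depend on [f] alone and tend to [c b * monomial b z], from which a nonzero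
    monomial can be divided out. *)
Lemma monomial_expansion_unique f c c' :
  monomial_expansion Omega f c -> monomial_expansion Omega f c' -> c = c'.
Proof.
move=> fc fc'; have [z Oz z0] := Reinhardt_nonzero_point.
apply/funext => b; have mz : monomial b z != 0.
  by apply/prodf_neq0 => i _; rewrite expf_neq0.
apply: (mulIf mz); apply/eqP; rewrite -subr_eq0; apply/eqP/eq0_normc.
apply/eqP; rewrite eq_le normc_ge0 andbT; apply/ler_addgt0Pr => e e0.
have e2 : 0 < e / 2 by lra.
have [N1 N1P] := coef_average Omega_Reinhardt fc Oz b e2.
have [N2 N2P] := coef_average Omega_Reinhardt fc' Oz b e2.
have l1 : (N1 < (N1 + N2).+1)%N by rewrite ltnS leq_addr.
have l2 : (N2 < (N1 + N2).+1)%N by rewrite ltnS leq_addl.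
move: (N1P _ l1) (N2P _ l2); set T := torus_average _ _ _ _ => h1 h2.
set x := c b * _ in h1 *; set y := c' b * _ in h2 *.
have -> : x - y = (T - y) - (T - x) by ring.
by rewrite (le_trans (normcB _ _))//; lra.
Qed.

(** The partial sums are constant once the index set contains [degree_fset n k]. With uniqueness
    this computes [coef] of a homogeneous part. *)
Lemma homog_part_expansion c k : monomial_expansion Omega (homog_part c k)
  (fun a => if total_degree a == k then c a else 0).
Proof.
move=> z _; apply/has_sumP => e e0; exists (degree_fset n k) => A kA.
rewrite [X in X - _](_ : _ = homog_part c k z) ?subrr ?normc0//.
rewrite /homog_part.
rewrite (_ : degree_fset n k = [fset a in A | a \in degree_fset n k]%fset).
  rewrite big_fset /= [RHS]big_mkcond; apply: eq_bigr => a _.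
  by rewrite in_degree_fset; case: ifP => //; rewrite mul0r.
apply/fsetP => a; rewrite !inE /=; have [ak|] := boolP (a \in degree_fset n k).
  by rewrite (fsubsetP kA).
by rewrite andbF.
Qed.

Lemma coef_eq f c : monomial_expansion Omega f c -> coef Omega f = c.
Proof.
move=> fc; apply: monomial_expansion_unique (fc) => //.
pose E := [set c | monomial_expansion Omega f c].
by apply: (@xgetPex _ (fun=> 0) E); exists c.
Qed.

Lemma homog_part_homog c k : homog_poly Omega k (homog_part c k).
Proof.
by exists c => z _; rewrite fsbig_finite//; exact: total_degree_finite.
Qed.

Lemma degree_fset0 : degree_fset n 0 = [fset [ffun=> 0%N]]%fset.
Proof.
apply/fsetP => a; rewrite in_degree_fset inE sum_nat_eq0.
apply/forallP/eqP => [a0|-> i]; last by rewrite ffunE.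
by apply/ffunP => i; rewrite ffunE; exact/eqP/(implyP (a0 i)).
Qed.

Lemma homog_part0 c z : homog_part c 0 z = c [ffun=> 0%N].
Proof.
rewrite /homog_part degree_fset0 big_seq_fset1 /monomial big1 ?mulr1// => i _.
by rewrite ffunE.
Qed.

End Uniqueness.

(** * Bounds for the homogeneous parts of a bounded function *)

Section Bounds.
Variables (R : realType) (n : nat) (Omega : set 'rV[Cplx R]_n).
Hypothesis Omega_Reinhardt : complete_Reinhardt_domain Omega.
Variables (f : Cfun R n) (c : multidx n -> Cplx R) (M : R).
Hypothesis fc : monomial_expansion Omega f c.
Hypothesis fM : forall z, Omega z -> normc (f z) <= M.
Local Notation root := (unity_root_exp R).

(** The weights of a circle average have modulus [1 / N], so the average is bounded by [M], and the
    homogeneous part is a limit of such averages. *)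
Lemma homog_part_le k z : Omega z -> normc (homog_part c k z) <= M.
Proof.
move=> Oz; apply/ler_addgt0Pr => e e0.
have [N0 /(_ _ (ltnSn _)) NP] := homog_part_average Omega_Reinhardt fc Oz k e0.
set N := N0.+1 in NP; set S := circle_average _ _ _ _ in NP.
have SM : normc S <= M.
  rewrite (le_trans (normc_sum _ _ _))//.
  rewrite -[leRHS](@mean_const _ N)//.
  apply: ler_sum => j _; rewrite 2!normcM normcV normc_natr.
  rewrite normcX normcV normcX normc_unity_root_exp expr1n invr1 expr1n mulr1.
  by rewrite ler_wpM2l// ?invr_ge0// fM//; exact: Reinhardt_rotate.
have -> : homog_part c k z = S - (S - homog_part c k z) by ring.
by rewrite (le_trans (normcB _ _))// lerD.
Qed.

(* Carathéodory: [M - Re (b f)] is nonnegative with mean [M - |c 0|], and its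
   [k]-th Fourier coefficient along the circle through [z] is half of that of
   [- b f], the conjugate term having no coefficient of index [k]. *)
Lemma homog_part_le_const k z : (0 < k)%N -> Omega z ->
  normc (homog_part c k z) <= 2 * (M - normc (c [ffun=> 0%N])).
Proof.
move=> k0 Oz; apply/ler_addgt0Pr => e e0; have e4 : 0 < e / 4 by lra.
have [N1 N1P] := homog_part_average Omega_Reinhardt fc Oz k e4.
have [N2 N2P] := homog_part_average Omega_Reinhardt fc Oz 0 e4.
have [N3 N3P] := negative_average Omega_Reinhardt fc Oz k0 e4.
pose N := (k + N1 + N2 + N3).+1.
have /N1P : (N1 < N)%N by rewrite /N; lia.
have /N2P : (N2 < N)%N by rewrite /N; lia.
have /N3P : (N3 < N)%N by rewrite /N; lia.
have kN : (k < N)%N by rewrite /N; lia.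
have prim : N.-primitive_root (root N) by exact: unity_root_exp_prim.
rewrite homog_part0 expr0 invr1.
set T := circle_average f z N; set c0 := c _ => T3 T2 T1.
(* With this [b] the real parts of [b * f] have mean close to the modulus of [c0]. *)
have [b b1 bc0] := rotate_to_nonneg c0.
pose fj (j : 'I_N) : R[i] := f (scale_coords (fun=> root N ^+ j) z).
pose h j := M - complex.Re (b * fj j).
have h0 j : 0 <= h j.
  rewrite subr_ge0 (le_trans (Re_le_normc _))// normcM b1 mul1r fM//.
  exact: Reinhardt_rotate.
(* Here [2 h = 2 M - b f - conj (b f)]. The constant averages to 0 because [0 < k < N], and
   conjugation exchanges the indices [k] and [- k]. *)
have key : \sum_(j < N) N%:R^-1 * (root N ^- k) ^+ j * (2 * h j)%:C%C =
    - (b * T (root N ^- k)) - (b * T (root N ^+ k))^*%C.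
  have rk1 : root N ^- k != 1.
    rewrite invr_eq1 -[X in _ != X](expr0 (root N)) (eq_prim_root_expr prim).
    by rewrite mod0n modn_small// gtn_eqF.
  have rkN : (root N ^- k) ^+ N = 1.
    by rewrite exprVn exprAC (prim_expr_order prim) expr1n invr1.
  have hE j : (2 * h j)%:C%C =
      (2 * M)%:C%C - b * fj j - (b * fj j)^*%C.
    rewrite /h; case: (b * fj j) => x y.
    by apply/eqP; rewrite eq_complex /=; apply/andP; split; apply/eqP; ring.
  have cE j : (N%:R^-1 * (root N ^+ k) ^+ j)^*%C =
      N%:R^-1 * (root N ^- k) ^+ j :> R[i].
    exact/conjc_unit_exp/normc_unity_root_exp.
  have conjM (x y : R[i]) : (x * y)^*%C = x^*%C * y^*%C by exact: rmorphM.
  rewrite /T /circle_average conjM rmorph_sum !mulr_sumr -!sumrN -!big_split /=.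
  transitivity (\sum_(j < N) (2 * M)%:C%C * (N%:R^-1 * (root N ^- k) ^+ j) +
     \sum_(j < N) (- (b * (N%:R^-1 * (root N ^- k) ^+ j * fj j))
       - b^*%C * (N%:R^-1 * (root N ^+ k) ^+ j * fj j)^*%C)).
    rewrite -big_split /=; apply: eq_bigr => j _.
    rewrite hE (conjM b) [in RHS]conjM cE -/(fj j); ring.
  by rewrite -mulr_sumr root_average// (negbTE rk1) mulr0 add0r.
(* Since [h] is nonnegative, the triangle inequality bounds the sum by twice the mean of [h]. *)
have norm_key : normc (\sum_(j < N) N%:R^-1 * (root N ^- k) ^+ j * (2 * h j)%:C%C)
    <= 2 * (M - complex.Re (b * T 1)).
  rewrite (le_trans (normc_sum _ _ _))//.
  have -> : 2 * (M - complex.Re (b * T 1)) = \sum_(j < N) N%:R^-1 * (2 * h j).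
    have -> : complex.Re (b * T 1) = \sum_(j < N) N%:R^-1 * complex.Re (b * fj j).
      rewrite /T /circle_average mulr_sumr Re_sum; apply: eq_bigr => j _.
      rewrite expr1n mulr1 mulrCA -(rmorph_nat (real_complex R)) -fmorphV.
      exact: ReZ.
    rewrite -[M in LHS](@mean_const _ N)// -sumrB mulr_sumr.
    by apply: eq_bigr => j _; rewrite /h; ring.
  apply: ler_sum => j _; rewrite 2!normcM normcV normc_natr.
  rewrite normcX normcV normcX normc_unity_root_exp expr1n invr1 expr1n mulr1.
  by rewrite normc_real// mulr_ge0.
have ReT : normc c0 - e / 4 <= complex.Re (b * T 1).
  have -> : normc c0 = complex.Re (b * T 1) + complex.Re (b * (c0 - T 1)).
    by rewrite -ReD -mulrDr addrC subrK bc0.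
  have := Re_le_normc (b * (c0 - T 1)).
  by rewrite normcM b1 mul1r normc_distC; lra.
have bT : normc (T (root N ^- k)) <= 2 * (M - complex.Re (b * T 1)) + e / 4.
  have -> : normc (T (root N ^- k)) = normc (- (b * T (root N ^- k))).
    by rewrite (@normcN R) normcM b1 mul1r.
  have -> : - (b * T (root N ^- k)) =
    (- (b * T (root N ^- k)) - (b * T (root N ^+ k))^*%C)
      + (b * T (root N ^+ k))^*%C.
    by rewrite subrK.
  rewrite -key (le_trans (normcD _ _))//.
  apply: lerD; first exact: norm_key.
  by rewrite (normc_conj (b * _)) normcM b1 mul1r.
set H := homog_part c k z in T1 *.
have -> : H = T (root N ^- k) - (T (root N ^- k) - H) by ring.
(* The error of the mean counts twice and those of the indices [k] and [- k] once each, which makes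
   four times [e / 4]. *)
by rewrite (le_trans (normcB _ _))//; lra.
Qed.

End Bounds.

(** * Holomorphy of homogeneous polynomials *)

Lemma near_eq_differentiable (K : numFieldType) (V W : normedModType K)
    (f g : V -> W) (x : V) :
  (\near x, f x = g x) -> differentiable g x -> differentiable f x.
Proof.
move=> fg dg; have fgx : f x = g x := nbhs_singleton fg.
have dgc := diff_continuous dg.
(* Only values near [x] enter the first-order expansion, so that of [g] is also one of [f]. *)
have fE : f \o shift x = cst (f x) + 'd g x +o_ 0 id.
  apply/eqaddoP => e e0; have := diff_locally dg; move/eqaddoP => /(_ e e0).
  have : \forall h \near (0 : V), f (h + x) = g (h + x).
    by move: fg; rewrite (near_shift 0) subr0.
  by apply: filterS2 => h /= fgh; rewrite !fctE /= fgh fgx.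
by apply/diff_locallyP; rewrite (diff_unique dgc fE).
Qed.

Section Holomorphy.
Variables (R : realType) (n : nat) (Omega : set 'rV[Cplx R]_n).

Lemma homog_part_differentiable (c : multidx n -> Cplx R) k z :
  differentiable (homog_part c k) z.
Proof.
rewrite /homog_part; elim: (enum_fset (degree_fset n k)) => [|a s IH].
  under eq_fun do rewrite big_nil.
  exact: differentiable_cst.
under eq_fun do rewrite big_cons.
apply: differentiableD => //.
apply: differentiableM; first exact: differentiable_cst.
rewrite /monomial; elim: (index_enum _) => [|i r IHr].
  under eq_fun do rewrite big_nil.
  exact: differentiable_cst.
under eq_fun do rewrite big_cons.
apply: differentiableM => //.
elim: (a i) => [|m IHm]; first exact: differentiable_cst.
under eq_fun do rewrite exprS.
by apply: differentiableM => //; exact: differentiable_coord.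
Qed.

(** Membership fixes [f] on [Omega] only; openness makes [f] agree with the polynomial near each
    point. *)
Lemma homog_poly_holomorphic k f : open Omega ->
  homog_poly Omega k f -> holomorphic_on Omega f.
Proof.
move=> Oo [c fc] z Oz.
apply: near_eq_differentiable (homog_part_differentiable c k z).
have : nbhs z Omega by exact: open_nbhs_nbhs.
apply: filterS => y /fc ->; rewrite fsbig_finite//; exact: total_degree_finite.
Qed.

End Holomorphy.

(** * Sums graded by total degree *)

Section GradedSums.
Variables (R : realType) (n : nat).

(** A finite set of indices lies in finitely many full degree slices, and [esum] is a supremum over
    finite sets. *)
Lemma esum_graded_le (T : multidx n -> R) (B : nat -> R) (X : R) :
  (forall a, 0 <= T a) -> (forall k, \sum_(a <- degree_fset n k) T a <= B k) ->
  (forall K, \sum_(k < K) B k <= X) ->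
  (\esum_(a in [set: multidx n]) (T a)%:E <= X%:E)%E.
Proof.
move=> T0 TB BX; apply: ge_ereal_sup => _ [A [finA _] <-].
rewrite fsbig_finite//= sumEFin lee_fin.
set A' := fset_set A; set K := (\max_(a <- A') total_degree a).+1.
rewrite (le_trans _ (BX K))//.
have deg_lt a : a \in A' -> (total_degree a < K)%N.
  by move=> aA; rewrite ltnS (leq_bigmax_seq _ aA).
have -> : \sum_(a <- A') T a =
    \sum_(k < K) \sum_(a <- A' | total_degree a == k) T a.
  under [RHS]eq_bigr do rewrite big_mkcond.
  rewrite exchange_big /= big_seq [RHS]big_seq; apply: eq_bigr => a aA.
  rewrite -big_mkcond (bigD1 (Ordinal (deg_lt _ aA)))//= big1 ?addr0// => i.
  by case/andP => /eqP ai; apply: contra_neqP => _; apply/val_inj.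
apply: ler_sum => k _; rewrite (le_trans _ (TB k))//.
rewrite [leRHS](big_fsetID _ (mem A'))/= -[leLHS]addr0 lerD ?sumr_ge0//.
rewrite (_ : [fset a in _ | _]%fset =
    [fset a in A' | total_degree a == k :> nat]%fset); first by rewrite big_fset.
by apply/fsetP => a; rewrite !inE /= in_degree_fset andbC.
Qed.

Lemma sum_geometric_le (q : R) K : 0 <= q < 1 ->
  \sum_(k < K) q ^+ k.+1 <= q / (1 - q).
Proof.
move=> /andP[q0 q1]; rewrite ler_pdivlMr ?subr_gt0//.
under eq_bigr do rewrite exprS.
rewrite -mulr_sumr -mulrA ler_piMr// -opprB mulrN mulrC -subrX1 opprB.
by rewrite lerBlDr lerDl exprn_ge0.
Qed.

End GradedSums.

(** * Scalar inequalities for the two values of [C] *)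

(** This is [x^p <= x] on the unit interval for [x = y / M], cleared of its denominator so that
    [M = 0] is covered. *)
Lemma powR_le_ratio (R : realType) (p y M : R) : 1 <= p -> 0 <= y <= M ->
  y `^ p * M <= M `^ p * y.
Proof.
move=> p1 /andP[y0 yM]; have p0 : p != 0 by rewrite gt_eqF// (lt_le_trans _ p1).
have [->|yn0] := eqVneq y 0; first by rewrite powR0// mul0r mulr0.
have y_gt0 : 0 < y by rewrite lt_def yn0.
have M_gt0 : 0 < M := lt_le_trans y_gt0 yM.
have -> : y = M * (y / M) by rewrite mulrC divfK// gt_eqF.
rewrite powRM ?divr_ge0 ?(ltW M_gt0)// -mulrA ler_wpM2l ?powR_ge0//.
rewrite [leRHS]mulrC ler_wpM2r ?(ltW M_gt0)//; apply: ge1r_powR => //.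
by rewrite divr_gt0//= ler_pdivrMr// mul1r.
Qed.

(** The ratio [q] solves [lambda q / (1 - q) = lambda - 1], so the geometric series leaves room for
    [M^p], which bounds the constant term. *)
Lemma graded_bound_geometric (R : realType) (p lambda a0 M q : R) K :
  1 <= p -> 1 <= lambda -> 0 <= a0 <= M ->
  q = (lambda - 1) / (2 * lambda - 1) ->
  a0 `^ p + \sum_(k < K) q ^+ k.+1 * (lambda * M `^ p) <= lambda * M `^ p.
Proof.
move=> p1 lambda1; have d0 : 0 < 2 * lambda - 1 by lra.
have dl : lambda - 1 < 2 * lambda - 1 by lra.
move=> /andP[a00 a0M] qE; have p0 : 0 <= p by rewrite (le_trans _ p1).
have q0 : 0 <= q by rewrite qE divr_ge0 ?(ltW d0) ?subr_ge0.
have q1 : q < 1 by rewrite qE ltr_pdivrMr// mul1r.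
have qq : q / (1 - q) * lambda = lambda - 1.
  by rewrite qE; field; apply/andP; split; lra.
have aM : a0 `^ p <= M `^ p.
  by rewrite ge0_ler_powR// nnegrE// (le_trans a00).
rewrite -mulr_suml.
have : (\sum_(k < K) q ^+ k.+1) * (lambda * M `^ p) <= (lambda - 1) * M `^ p.
  rewrite mulrA ler_wpM2r ?powR_ge0// -qq ler_wpM2r ?sum_geometric_le ?q0//.
  by rewrite (le_trans _ lambda1).
by lra.
Qed.

(** The positive powers of [1 / 3] sum to [1 / 2], which cancels the 2 in the bound on [m]. After
    multiplication by [M], the constant term is at most [M^p a0] and the tail at most
    [lambda M^p (M - a0)]; [lambda >= 1] concludes. *)
Lemma graded_bound_third (R : realType) (p lambda a0 M m : R) K :
  1 <= p -> 1 <= lambda -> 0 <= a0 <= M -> 0 <= m <= M ->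
  m <= 2 * (M - a0) ->
  a0 `^ p + \sum_(k < K) ((1 / 3) `^ p) ^+ k.+1 * (lambda * m `^ p)
    <= lambda * M `^ p.
Proof.
move=> p1 lambda1 /andP[a00 a0M] /andP[m0 mM] ma; have l0 : 0 <= lambda by lra.
have p0 : p != 0 by rewrite gt_eqF// (lt_le_trans _ p1).
have [M0|Mn0] := eqVneq M 0.
  have -> : a0 = 0 by lra.
  have -> : m = 0 by lra.
  rewrite M0 powR0// mulr0 add0r big1// => k _.
  by rewrite mulr0.
have M_gt0 : 0 < M by rewrite lt_def Mn0 (le_trans m0).
have third0 : 0 <= 1 / 3 :> R by lra.
pose y (k : nat) : R := (1 / 3) ^+ k.+1 * m.
have yE (t : R) k : 0 <= t ->
    (t `^ p) ^+ k * (lambda * m `^ p) = lambda * (t ^+ k * m) `^ p.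
  move=> t0; rewrite powRM ?exprn_ge0// -(powR_mulrn _ (powR_ge0 _ _)).
  by rewrite -(powR_mulrn _ t0) powRAC mulrCA.
under eq_bigr do rewrite yE// -/(y _).
rewrite -mulr_sumr -(ler_pM2r M_gt0) mulrDl.
have y_le : (\sum_(k < K) y k `^ p) * M <= M `^ p * (M - a0).
  apply: (@le_trans _ _ (M `^ p * \sum_(k < K) y k)).
    rewrite mulr_suml mulr_sumr; apply: ler_sum => k _; apply: powR_le_ratio => //.
    rewrite /y mulr_ge0 ?exprn_ge0//= (le_trans _ mM)// ler_piMl// exprn_ile1//.
    lra.
  rewrite ler_wpM2l ?powR_ge0// /y -mulr_suml.
  have /(@sum_geometric_le R _ K) : 0 <= (1 / 3 : R) < 1 by lra.
  have -> : (1 / 3) / (1 - 1 / 3) = 1 / 2 :> R by field.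
  by move=> /(ler_wpM2r m0); lra.
have a_le : a0 `^ p * M <= M `^ p * a0 by rewrite powR_le_ratio// a00.
have Ma : 0 <= M `^ p * a0 by rewrite mulr_ge0 ?powR_ge0.
have := ler_wpM2l l0 y_le; nra.
Qed.

(** * Transfer of admissible radii between the two families *)

Section BohrTransfer.
Variables (R : realType) (n : nat) (Omega : set 'rV[Cplx R]_n) (p lambda : R).
Hypotheses (Omega_Reinhardt : complete_Reinhardt_domain Omega)
  (lambda1 : 1 <= lambda) (p1 : 1 <= p).
Implicit Types (f : Cfun R n) (c : multidx n -> Cplx R) (r : 'rV[R]_n).
Local Notation P := (\bigcup_(k in [set k : nat | (1 <= k)%N]) homog_poly Omega k).

Lemma sup_norm_ge0 f : (0 <= sup_norm Omega f)%E.
Proof.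
have [_ _ [z Oz] _] := Omega_Reinhardt.
apply: (@le_trans _ _ (normc (f z))%:E); first by rewrite lee_fin normc_ge0.
by apply: ereal_sup_ubound; exists z.
Qed.

Lemma normc_le_sup_norm f z : Omega z -> ((normc (f z))%:E <= sup_norm Omega f)%E.
Proof. by move=> Oz; apply: ereal_sup_ubound; exists z. Qed.

Lemma admissible_homog_poly r : Bohr_admissible Omega p (H_infty Omega) lambda r ->
  Bohr_admissible Omega p P lambda r.
Proof.
move=> [r0 rH]; split=> // f [k k1 fk].
have [foo|] := eqVneq (sup_norm Omega f) +oo%E.
  rewrite foo poweRyr; last by rewrite gt_eqF// (lt_le_trans _ p1).
  by rewrite gt0_muley ?leey// lte_fin (lt_le_trans _ lambda1).
rewrite -ltey => foo; apply: rH; split.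
  by apply: homog_poly_holomorphic fk; case: Omega_Reinhardt.
exists (fine (sup_norm Omega f)) => z Oz.
rewrite -lee_fin fineK; first exact: normc_le_sup_norm.
by rewrite ge0_fin_numE ?sup_norm_ge0.
Qed.

Definition Bohr_weight c r (a : multidx n) : R :=
  normc (c a) `^ p * \prod_i r 0 i `^ (p * (a i)%:R).

Lemma Bohr_weight_ge0 c r a : 0 <= Bohr_weight c r a.
Proof. by rewrite mulr_ge0 ?powR_ge0// prodr_ge0// => i _; exact: powR_ge0. Qed.

Lemma Bohr_weight_scale c r (C : R) a : 0 <= C -> (forall i, 0 <= r 0 i) ->
  Bohr_weight c (C *: r) a = (C `^ p) ^+ total_degree a * Bohr_weight c r a.
Proof.
move=> C0 r0; rewrite /Bohr_weight mulrCA; congr (_ * _).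
rewrite /total_degree -prodrXr -big_split /=; apply: eq_bigr => i _.
by rewrite mxE powRM// powRrM powR_mulrn ?powR_ge0.
Qed.

(** Admissibility is tested on the single polynomial [homog_part c k], which belongs to [P] because
    [k] is positive. *)
Lemma degree_Bohr_weight_le c r k (m : R) :
  Bohr_admissible Omega p P lambda r -> (0 < k)%N ->
  (forall z, Omega z -> normc (homog_part c k z) <= m) ->
  \sum_(a <- degree_fset n k) Bohr_weight c r a <= lambda * m `^ p.
Proof.
move=> [r0 rP] k0 cm; have p0 : 0 < p by rewrite (lt_le_trans _ p1).
have m0 : 0 <= m.
  have [_ _ [z Oz] _] := Omega_Reinhardt.
  by rewrite (le_trans (normc_ge0 _) (cm z Oz)).
have Pc : P (homog_part c k) by exists k => //; exact: homog_part_homog.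
have := rP _ Pc.
rewrite (coef_eq Omega_Reinhardt (@homog_part_expansion _ _ Omega c k)).
set E := esum _ _ => El.
rewrite -lee_fin; apply: (@le_trans _ _ E).
  apply: esum_ge; exists [set a : multidx n | total_degree a = k].
    by split=> //; exact: total_degree_finite.
  rewrite fsbig_finite; last exact: total_degree_finite.
  rewrite -/(degree_fset n k) sumEFin lee_fin big_seq [leRHS]big_seq.
  by apply: ler_sum => a; rewrite in_degree_fset => ->.
rewrite (le_trans El)// EFinM lee_wpmul2l ?lee_fin ?(le_trans ler01)//.
rewrite -poweR_EFin; apply: gt0_ler_poweR; first exact: ltW.
- by rewrite in_itv /= leey sup_norm_ge0.
- by rewrite in_itv /= leey lee_fin m0.
- by apply: ge_ereal_sup => _ [z Oz <-]; rewrite lee_fin cm.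
Qed.

Lemma admissible_H_infty r (C : R) : Bohr_admissible Omega p P lambda r ->
  0 <= C -> C = 1 / 3 \/ C `^ p = (lambda - 1) / (2 * lambda - 1) ->
  Bohr_admissible Omega p (H_infty Omega) lambda (C *: r).
Proof.
move=> rP C0 CE; have [r0 _] := rP; have l0 : 0 <= lambda := le_trans ler01 lambda1.
split=> [i|f [_ [M0 fM0]]]; first by rewrite mxE mulr_ge0.
have [[c fc]|nofc] := pselect (exists c, monomial_expansion Omega f c); last first.
  (* The default value of [coef] is 0, whose power [p] vanishes since [p] is nonzero. *)
  rewrite /coef xgetPN; last by move=> c fc; apply: nofc; exists c.
  rewrite esum1 ?mule_ge0 ?poweR_ge0 ?lee_fin// => a _.
  by rewrite normc0 powR0 ?mul0r// gt_eqF// (lt_le_trans _ p1).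
rewrite (coef_eq Omega_Reinhardt fc).
have sup_fin : sup_norm Omega f \is a fin_num.
  rewrite ge0_fin_numE ?sup_norm_ge0// (@le_lt_trans _ _ M0%:E) ?ltey//.
  by apply: ge_ereal_sup => _ [z Oz <-]; rewrite lee_fin fM0.
set M := fine (sup_norm Omega f).
have supE : sup_norm Omega f = M%:E by rewrite fineK.
have fM z : Omega z -> normc (f z) <= M.
  by move=> /(normc_le_sup_norm f); rewrite supE lee_fin.
rewrite supE poweR_EFin -EFinM.
set a0 := normc (c [ffun=> 0%N]).
have [z Oz _] := Reinhardt_nonzero_point Omega_Reinhardt.
have a0M : a0 <= M.
  by rewrite /a0 -(homog_part0 c z); exact: homog_part_le fM _ _ Oz.
have a00 : 0 <= a0 := normc_ge0 _.
(* One [m] serves all positive degrees: [M] for the geometric choice of [C], and the smaller of [M]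
   and the Caratheodory bound for [1 / 3]. *)
have [m hm mM] : exists2 m, (forall k z, (0 < k)%N -> Omega z ->
    normc (homog_part c k z) <= m) & forall K, a0 `^ p +
    \sum_(k < K) (C `^ p) ^+ k.+1 * (lambda * m `^ p) <= lambda * M `^ p.
  case: CE => [->|qE]; last first.
    exists M => [k y _ Oy|K]; first exact: homog_part_le fM _ _ Oy.
    by apply: graded_bound_geometric => //; rewrite a00.
  exists (Num.min M (2 * (M - a0))) => [k y k0 Oy|K].
    rewrite le_min (homog_part_le Omega_Reinhardt fc fM)//=.
    exact: (homog_part_le_const Omega_Reinhardt fc fM).
  apply: graded_bound_third => //; first by rewrite a00.
    by rewrite le_min ge_min lexx /=; lra.
  by rewrite ge_min lexx orbT.
under eq_esum do rewrite -/(Bohr_weight c (C *: r) _) Bohr_weight_scale//.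
(* The family [P] starts at degree 1, so the slice of degree 0 is bounded by its own value. *)
pose B k := if k is k'.+1 then (C `^ p) ^+ k * (lambda * m `^ p) else a0 `^ p.
apply: (@esum_graded_le _ _ _ B) => [a|[|k]|[|K]].
- by rewrite mulr_ge0 ?Bohr_weight_ge0 ?exprn_ge0 ?powR_ge0.
- rewrite degree_fset0 big_seq_fset1 /total_degree big1 ?mul1r; last first.
    by move=> i _; rewrite ffunE.
  by rewrite /Bohr_weight big1 ?mulr1// => i _; rewrite ffunE mulr0 powRr0.
- rewrite (eq_big_seq (fun a => (C `^ p) ^+ k.+1 * Bohr_weight c r a)).
    rewrite -mulr_sumr ler_wpM2l ?exprn_ge0 ?powR_ge0//.
    by apply: degree_Bohr_weight_le => // y Oy; exact: hm.
  by move=> a; rewrite in_degree_fset => /eqP ->.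
- by rewrite big_ord0 mulr_ge0 ?powR_ge0.
- by rewrite big_ord_recl; exact: mM.
Qed.

End BohrTransfer.

Theorem theorem2p1 (R : realType) (n : nat) (Omega : set 'rV[Cplx R]_n)
    (lambda p : R) :
  (0 < n)%N -> complete_Reinhardt_domain Omega -> 1 <= lambda -> 1 <= p ->
  let C : R := Num.max (1 / 3) (((lambda - 1) / (2 * lambda - 1)) `^ (1 / p)) in
  let P := \bigcup_(k in [set k : nat | (1 <= k)%N]) homog_poly Omega k in
  (C%:E * arith_Bohr_radius Omega p P lambda
     <= arith_Bohr_radius Omega p (H_infty Omega) lambda)%E /\
  (arith_Bohr_radius Omega p (H_infty Omega) lambda
     <= arith_Bohr_radius Omega p P lambda)%E.
Proof.
move=> n0 OR l1 p1 C P; split; last first.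
  apply: ereal_sup_le => _ [r rH <-]; exists r => //.
  exact: admissible_homog_poly.
(* The entry [1 / 3] keeps [C] positive, which permits dividing the extended inequality by [C]. *)
have C_gt0 : 0 < C by rewrite lt_max divr_gt0.
have CE : C = 1 / 3 \/ C `^ p = (lambda - 1) / (2 * lambda - 1).
  rewrite /C; case: leP => _; [right|by left].
  rewrite -powRrM div1r mulVf ?powRr1//; last by rewrite gt_eqF// (lt_le_trans _ p1).
  by rewrite divr_ge0//; lra.
(* After division by [C] the supremum is tested at each admissible [r], with [C *: r] as the witness
   on the other side. *)
rewrite muleC -lee_pdivlMr//; apply: ge_ereal_sup => _ [r rP <-].
rewrite lee_pdivlMr// -EFinM; apply: ereal_sup_ubound; exists (C *: r).
  by apply: admissible_H_infty => //; exact: ltW.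
congr EFin; rewrite -mulrA; congr (_ * _); rewrite mulr_suml.
by apply: eq_bigr => i _; rewrite mxE mulrC.
Qed.
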